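(* Let $\varepsilon\in(0,1/2)$ and let $\mathcal M$ be a dynamic matroid that at any moment contains at most $n$ elements. If the fractional covering number $\beta$ of the current matroid is at all times bounded by $\beta_{\max}$, then one can deterministically maintain a value $\tilde\beta$ with $(1-\varepsilon)\beta\le\tilde\beta\le(1+\varepsilon)\beta$ using $O(\beta_{\max}^2\cdot\varepsilon^{-4}\cdot\log^3 n)$ worst-case rank-queries per update.
   Context: A matroid $\mathcal M=(E,\mathcal I)$ has rank function $\mathrm{rk}(A)=\max\{|A'|:A'\in\mathcal I, A'\subseteq A\}$. The fractional covering number is $\beta_{\mathcal M}=\max\{|A|/\mathrm{rk}(A): A\subseteq E, A\neq\emptyset\}$. The algorithm accesses the matroid only through a rank oracle returning $\mathrm{rk}(A)$ for a query $A$ of the current ground set. A dynamic matroid undergoes updates: deleting $e$ restricts $\mathcal M$ to $E\setminus\{e\}$; inserting $e$ replaces $\mathcal M$ by a matroid on $E\cup\{e\}$ with independent sets $\mathcal I\cup\mathcal I_e$ where every set in $\mathcal I_e$ contains $e$ (chosen by an adversary). The cost of an update is the number of rank-oracle queries made to process it. *)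

(* Defs.v *)
From HB Require Import structures.
From mathcomp Require Import all_boot all_order all_algebra.
From mathcomp Require Import finmap.
From mathcomp Require Import all_classical all_reals all_analysis.
Set Implicit Arguments.
Unset Strict Implicit.
Unset Printing Implicit Defensive.
Import Order.TTheory GRing.Theory Num.Theory.
Local Open Scope fset_scope.

Record matroid (U : choiceType) := Matroid {
  ground : {fset U};
  indep : {fset {fset U}};
  indep_ground : forall I, I \in indep -> I `<=` ground;
  indep0 : fset0 \in indep;
  indep_sub : forall I J, J \in indep -> I `<=` J -> I \in indep;
  indep_exchange : forall I J, I \in indep -> J \in indep ->
    #|` I| < #|` J| -> exists2 x, x \in J `\` I & x |` I \in indep }.

Definition rk (U : choiceType) (M : matroid U) (A : {fset U}) : nat :=
  \max_(I <- indep M | I `<=` A) #|` I|.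

(* Extended reals, with x / 0 = +oo for x > 0: the value is +oo exactly when M
   has a loop. It is 0 when the ground set is empty. *)
Definition fractional_covering (R : realType) (U : choiceType)
    (M : matroid U) : \bar R :=
  (\big[maxe/0]_(A <- fpowerset (ground M) | A != fset0)
     ((#|` A|%:R)%:E / ((rk M A)%:R)%:E))%E.

Inductive update (U : Type) := Insert of U | Delete of U.
Arguments Insert {U} _.
Arguments Delete {U} _.

Definition update_spec (U : choiceType) (u : update U) (M M' : matroid U) :
    Prop :=
  match u with
  | Insert e =>
      [/\ e \notin ground M, ground M' = e |` ground M &
        exists2 Ie : {fset {fset U}}, (forall I, I \in Ie -> e \in I) &
          indep M' = indep M `|` Ie]
  | Delete e =>
      [/\ e \in ground M, ground M' = ground M `\ e &
        indep M' = [fset I in indep M | I `<=` ground M `\ e]]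
  end.

(* M t is the matroid after t updates and u t the update from M t to M t.+1;
   only the values up to the horizon T matter. *)
Definition dynamic_matroid (U : choiceType) (T : nat) (M : nat -> matroid U)
    (u : nat -> update U) : Prop :=
  forall t, t < T -> update_spec (u t) (M t) (M t.+1).

(* Deterministic adaptive computations with result in X that can query an
   oracle from finite sets to natural numbers. *)
Inductive query_prog (U : choiceType) (X : Type) :=
| Return of X
| Query of {fset U} & (nat -> query_prog U X).

Fixpoint result (U : choiceType) (X : Type) (oracle : {fset U} -> nat)
    (p : query_prog U X) : X :=
  match p with
  | Return x => x
  | Query A k => result oracle (k (oracle A))
  end.

Fixpoint queries (U : choiceType) (X : Type) (oracle : {fset U} -> nat)
    (p : query_prog U X) : seq {fset U} :=
  match p with
  | Return _ => [::]
  | Query A k => A :: queries oracle (k (oracle A))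
  end.

(* The matroid is seen only through rank queries: besides their answers, the
   algorithm is given the initial ground set and the name of each inserted or
   deleted element. *)
Record dyn_algorithm (R : Type) (U : choiceType) := DynAlgorithm {
  state : Type;
  init : {fset U} -> query_prog U state;
  process : update U -> state -> query_prog U state;
  output : state -> R }.
Arguments init {R U} _ _.
Arguments process {R U} _ _ _.
Arguments output {R U} _ _.

Section Execution.
Variables (R : Type) (U : choiceType) (alg : dyn_algorithm R U).
Variables (M : nat -> matroid U) (u : nat -> update U).

Fixpoint state_at (t : nat) : state alg :=
  match t with
  | 0 => result (rk (M 0)) (init alg (ground (M 0)))
  | s.+1 => result (rk (M s.+1)) (process alg (u s) (state_at s))
  end.

Definition queries_at (t : nat) : seq {fset U} :=
  match t with
  | 0 => queries (rk (M 0)) (init alg (ground (M 0)))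
  | s.+1 => queries (rk (M s.+1)) (process alg (u s) (state_at s))
  end.

Definition output_at (t : nat) : R := output alg (state_at t).

End Execution.

(* Main.v *)
(* Keep k bases B_0, ..., B_(k-1), where B_i has minimum weight for the load
   L_i(f) = #{j < i : f \in B_j}, ties being broken by a fixed total order, and
   output k / m for m the least final load. If A is a densest set, its total load
   is at most k rk(A), so m <= k / beta. Conversely put weight (1 + d)^(-load) on
   the elements: a base of minimum load has maximum weight, hence carries at least
   a fraction 1 / beta of the total weight, so that the total weight decays like
   exp(-k d / ((1 + d) beta)), while it is at least (1 + d)^(-m). With d = eps / 4
   and k of order bmax log n / eps^2 this gives m >= k / ((1 + eps) beta).

   Deleting e can only raise the loads of the other elements, and the total load
   of the first i bases is i times the rank, so at most i other loads change at
   level i. An element of B_i other than e whose load is unchanged stays in the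
   new B_i; hence the new base differs from the old one in O(i) elements, each of
   which is located by bisection with O(log n) rank queries. An insertion is a
   deletion read backwards. The total is O(k^2 log n) queries. *)
Require Import Defs.
From HB Require Import structures.
From mathcomp Require Import all_boot all_order all_algebra.
From mathcomp Require Import finmap.
From mathcomp Require Import all_classical all_reals all_analysis.
From mathcomp Require Import wochoice zify ring lra.
Import Order.TTheory GRing.Theory Num.Theory.
Set Implicit Arguments.
Unset Strict Implicit.
Unset Printing Implicit Defensive.
Local Open Scope fset_scope.
Local Open Scope nat_scope.

(** * Rank function *)

Section MatroidRank.
Variables (U : choiceType) (M : matroid U).
Implicit Types (A B D I J : {fset U}) (x : U).

Lemma indep_le_rk I A : I \in indep M -> I `<=` A -> #|` I| <= rk M A.
Proof. by move=> IM IA; apply: (bigmaxn_sup_seq I). Qed.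

Lemma rk_basis A : exists2 I, I \in indep M & I `<=` A /\ #|` I| = rk M A.
Proof.
rewrite /rk big_seq_cond.
elim/big_ind: _ => [|m n [I IM [IA <-]] [J JM [JA <-]]|I /andP[IM IA]].
- by exists fset0; rewrite ?indep0// fsub0set cardfs0.
- by case: (leqP #|` I| #|` J|) => _; [exists J|exists I].
- by exists I.
Qed.

Lemma rk_le_card A : rk M A <= #|` A|.
Proof. by apply/bigmax_leqP_seq => I _; apply: fsubset_leq_card. Qed.

Lemma rkS A B : A `<=` B -> rk M A <= rk M B.
Proof.
move=> AB; apply/bigmax_leqP_seq => I IM IA.
by apply: indep_le_rk => //; apply: fsubset_trans AB.
Qed.

Lemma rk_indep I : I \in indep M -> rk M I = #|` I|.
Proof.
by move=> IM; apply/eqP; rewrite eqn_leq rk_le_card indep_le_rk.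
Qed.

Lemma indep_extend I A : I \in indep M -> I `<=` A ->
  exists2 J, J \in indep M & [/\ I `<=` J, J `<=` A & #|` J| = rk M A].
Proof.
have [m] := ubnP (rk M A - #|` I|); elim: m I => // m IH I ltm IM IA.
have := indep_le_rk IM IA; rewrite leq_eqVlt => /orP[/eqP eqI|ltI].
  by exists I.
have [J JM [JA cJ]] := rk_basis A.
have [|x] := indep_exchange IM JM; first by rewrite cJ.
rewrite inE => /andP[xI xJ] xIM.
have xIA : x |` I `<=` A by rewrite fsubUset fsub1set (fsubsetP JA)//=.
have [|K KM [xK KA cK]] := IH _ _ xIM xIA.
  by rewrite cardfsU1 xI; move: ltm ltI; lia.
by exists K => //; split=> //; apply: fsubset_trans xK; apply: fsubsetU1.
Qed.

Lemma rkU1 x A : rk M (x |` A) <= (rk M A).+1.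
Proof.
have [I IM [IA <-]] := rk_basis (x |` A).
have /(indep_le_rk _): I `\ x `<=` A by rewrite fsubDset.
move=> /(_ (indep_sub IM (fsubD1set _ _))) le.
by rewrite (cardfsD1 x); case: (x \in I) => /=; lia.
Qed.

(** Submodularity in marginal form. A basis [I] of [A] grows to a basis of [B] and then of [x |]
    B[; the last one must contain]x[, so]x |[I] is independent. *)
Lemma rkU1_sub x A B : A `<=` B -> rk M B < rk M (x |` B) ->
  rk M A < rk M (x |` A).
Proof.
move=> AB ltB; have [I IM [IA <-]] := rk_basis A.
have [J JM [IJ JB cJ]] := indep_extend IM (fsubset_trans IA AB).
have [K KM [JK KB cK]] := indep_extend JM (fsubset_trans JB (fsubsetU1 x B)).
have xK : x \in K.
  apply: contraLR ltB => xK; rewrite -leqNgt -cK; apply: indep_le_rk => //.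
  apply/fsubsetP => y yK; have /(fsubsetP KB) := yK.
  by rewrite !inE => /orP[/eqP yx|//]; rewrite -yx yK in xK.
have xB : x \notin B.
  apply: contraL ltB => xB; rewrite -leqNgt; apply: rkS.
  by rewrite fsubUset fsub1set xB /=.
have xI : x \notin I by apply: contra xB => /(fsubsetP IA)/(fsubsetP AB).
have <- : #|` x |` I| = #|` I|.+1 by rewrite cardfsU1 xI.
apply: indep_le_rk; last exact: fsetUS.
by apply: indep_sub KM _; rewrite fsubUset fsub1set xK (fsubset_trans IJ).
Qed.

(** Otherwise exchange adds some [x] to a basis [J] of [A]|[D] that extends a basis [I] of [A]. If
    [x] is in [B], then [x |] I[exceeds the rank of]B[; if]x[is in]D[, then]x |[J] exceeds that of
    [A]|[D]. *)
Lemma rk_spanU A B D : A `<=` B -> rk M A = rk M B ->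
  rk M (A `|` D) = rk M (B `|` D).
Proof.
move=> AB eqAB; apply/eqP; rewrite eqn_leq rkS ?fsetSU//= leqNgt.
apply/negP => lt; have [I IM [IA cI]] := rk_basis A.
have [J JM [IJ JAD cJ]] := indep_extend IM (fsubset_trans IA (fsubsetUl A D)).
have [K KM [KBD cK]] := rk_basis (B `|` D).
have [|x] := indep_exchange JM KM; first by rewrite cJ cK.
rewrite inE => /andP[xJ xK] xJM.
have /fsetUP[xB|xD] : x \in B `|` D by apply: (fsubsetP KBD).
  have xI : x \notin I by apply: contra xJ => /(fsubsetP IJ).
  have /indep_le_rk : x |` I \in indep M.
    by apply: indep_sub xJM _; apply: fsetUS.
  move=> /(_ B); rewrite fsubUset fsub1set xB (fsubset_trans IA)// => /(_ isT).
  by rewrite cardfsU1 xI cI eqAB add1n ltnn.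
have /(_ (A `|` D)) := indep_le_rk xJM.
rewrite fsubUset fsub1set inE xD orbT JAD => /(_ isT).
by rewrite cardfsU1 xJ cJ add1n ltnn.
Qed.

End MatroidRank.

(** * Counting in finite sets *)

Lemma in_fset_cond (U : choiceType) (s : finmempred U) (P : pred U) x :
  (x \in [fset y in s | P y]) = (in_mem x s) && P x.
Proof. by rewrite !inE. Qed.

Lemma card_fset_count (U : choiceType) (s : seq U) (P : pred U) : uniq s ->
  #|` [fset x in s | P x]| = count P s.
Proof.
move=> Us; have -> : [fset x in s | P x] = [fset x in [seq x <- s | P x]].
  by apply/fsetP => x; rewrite !inE mem_filter andbC.
by rewrite card_fseq undup_id ?seq.filter_uniq// size_filter.
Qed.

Lemma card_fset_cond (U : choiceType) (A : {fset U}) (P : pred U) :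
  #|` [fset x in A | P x]| = count P A.
Proof.
rewrite -card_fset_count ?fset_uniq//; congr (#|` _|).
by apply/fsetP => x; rewrite !in_fset_cond.
Qed.

Lemma count_mem_fset (U : choiceType) (s : seq U) (X : {fset U}) : uniq s ->
  {subset X <= s} -> count (mem X) s = #|` X|.
Proof.
move=> Us Xs; rewrite -card_fset_count//; congr (#|` _|).
apply/fsetP => x; rewrite !inE /=; have [xX|] := boolP (x \in X).
  by rewrite Xs.
by rewrite andbF.
Qed.

(** * Minimum bases and their recourse *)

Section MinimumBase.
Variables (U : choiceType) (ord : rel U).
Hypotheses (ord_total : total ord) (ord_anti : antisymmetric ord)
  (ord_trans : transitive ord).
Implicit Types (L : U -> nat) (E A D : {fset U}).

Definition load_le L : rel U :=
  fun f g => (L f < L g) || (L f == L g) && ord f g.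

Lemma load_le_total L : total (load_le L).
Proof.
by move=> f g; rewrite /load_le; case: ltngtP => //= _; apply: ord_total.
Qed.

Lemma load_le_anti L : antisymmetric (load_le L).
Proof.
by move=> f g; rewrite /load_le; case: ltngtP => //= _; apply: ord_anti.
Qed.

Lemma load_le_trans L : transitive (load_le L).
Proof.
move=> g f h; rewrite /load_le => /orP[fg|/andP[/eqP -> fg]].
  by move=> /orP[gh|/andP[/eqP <- _]]; rewrite ?fg// (ltn_trans fg gh).
by move=> /orP[->//|/andP[-> gh]]; rewrite (ord_trans fg gh) orbT.
Qed.

Definition below E L f := [fset g in E | load_le L g f && (g != f)].

(** Kruskal's base without recursion: [f] is kept when the elements before it do not span it.
    Comparing the bases of two matroids thus reduces to comparing marginal ranks. *)
Definition minbase (M : matroid U) L :=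
  let P := below (ground M) L in
  [fset f in ground M | rk M (P f) < rk M (f |` P f)].

Lemma in_below E L f g :
  (g \in below E L f) = [&& g \in E, load_le L g f & g != f].
Proof. exact: in_fset_cond. Qed.

Lemma in_minbase M L f : (f \in minbase M L) = (f \in ground M) &&
  (rk M (below (ground M) L f) < rk M (f |` below (ground M) L f)).
Proof. exact: in_fset_cond. Qed.

Lemma minbase_ground M L : minbase M L `<=` ground M.
Proof. by apply/fsubsetP => f; rewrite !inE => /andP[]. Qed.

Definition by_load L E : seq U := sort (load_le L) E.

Lemma mem_by_load L E : by_load L E =i E.
Proof. by move=> x; rewrite mem_sort. Qed.

Lemma below_by_load L E p f q : by_load L E = p ++ f :: q ->
  below E L f = [fset g in p].
Proof.
move=> s_eq.
have : pairwise (load_le L) (by_load L E).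
  rewrite -(sorted_pairwise (@load_le_trans L)).
  exact: sort_sorted (@load_le_total L) _.
have : uniq (by_load L E) by rewrite sort_uniq fset_uniq.
rewrite s_eq pairwise_cat /= allrel_consr => Us.
move=> /and4P[/andP[/allP pf _] _ /allP fq _].
apply/fsetP => g; rewrite !inE -(mem_by_load L E) s_eq mem_cat inE.
move: Us; rewrite cat_uniq => /and3P[_ /hasPn/= pfq /andP[fNq _]].
have [gp|gp] /= := boolP (g \in p).
  rewrite pf//=; apply: contraTneq gp => ->; apply: pfq.
  by rewrite inE eqxx.
case: eqVneq => [->|gf]; rewrite ?andbF//= andbT.
apply/negP => /andP[gq lgf]; have /load_le_anti : load_le L g f && load_le L f g.
  by rewrite lgf fq.
by move/eqP; apply/negP.
Qed.

Lemma prefix_rcons_inv (T : eqType) (p s : seq T) x :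
  prefix (rcons p x) s -> prefix p s /\ exists q, s = p ++ x :: q.
Proof.
move=> /prefixP[q ->]; rewrite cat_rcons prefix_prefix; split => //.
by exists q.
Qed.

Lemma fset_rcons (p : seq U) f (P : pred U) :
  [fset x in rcons p f | P x] =
  if P f then f |` [fset x in p | P x] else [fset x in p | P x].
Proof.
apply/fsetP => x; case: ifP => Pf; rewrite !inE mem_rcons inE;
  by case: eqVneq => //= ->; rewrite Pf ?andbF.
Qed.

Section OneMatroid.
Variables (M : matroid U) (L : U -> nat).
Let E := ground M.
Let B := minbase M L.

(** Appending [f] raises the rank of the prefix exactly when [f] is in [B], and by [rkU1_sub] it
    then also raises the rank of the part inside [B]. So that part is independent and spans the
    prefix. *)
Lemma minbase_prefix p : prefix p (by_load L E) ->
  rk M [fset x in p] = count (mem B) p /\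
  rk M [fset x in p | x \in B] = count (mem B) p.
Proof.
elim/last_ind: p => [|p f IH] /=.
  rewrite (_ : [fset x in _] = fset0); last by apply/fsetP => x; rewrite !inE.
  rewrite (_ : [fset x in _ | _] = fset0); last by apply/fsetP => x; rewrite !inE.
  by rewrite rk_indep ?indep0// cardfs0.
move=> /prefix_rcons_inv[/IH[rkp rkpB] [q s_eq]].
have blw := below_by_load s_eq.
have fE : f \in E by rewrite -(mem_by_load L) s_eq mem_cat inE eqxx orbT.
have -> : [fset x in rcons p f] = f |` [fset x in p].
  by apply/fsetP => x; rewrite !inE mem_rcons inE.
pose P := [fset x in p]; pose Q := [fset x in p | x \in B].
have -> : [fset x in rcons p f | x \in B] = if f \in B then f |` Q else Q.
  exact: (fset_rcons p f (fun x => x \in B)).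
have -> : count (mem B) (rcons p f) = count (mem B) p + (f \in B).
  by rewrite -cats1 count_cat /= addn0.
rewrite -/P; move: rkp rkpB; rewrite -/P -[rk M [fset x in p | _]]/(rk M Q).
have fB : (f \in B) = (rk M P < rk M (f |` P)) by rewrite !inE/= blw -/E fE.
have QP : Q `<=` P by apply/fsubsetP => x; rewrite !inE => /andP[].
have := rkU1 M f P; have := rkS M (fsubsetU1 f P); have := rkU1 M f Q.
case: ifP; rewrite fB => ltf; last by move=> *; split; lia.
by have := rkU1_sub QP ltf; move=> *; split; lia.
Qed.

Lemma by_load_fset : [fset x in by_load L E] = E.
Proof. by apply/fsetP => x; rewrite !inE mem_by_load. Qed.

Lemma count_minbase : count (mem B) (by_load L E) = #|` B|.
Proof.
rewrite count_mem_fset ?sort_uniq ?fset_uniq// => x.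
by move=> /(fsubsetP (minbase_ground M L)); rewrite mem_by_load.
Qed.

Lemma indep_minbase : B \in indep M.
Proof.
have [_] := minbase_prefix (prefix_refl (by_load L E)).
rewrite count_minbase (_ : [fset x in _ | _] = B); last first.
  apply/fsetP => x; rewrite in_fset_cond mem_by_load andb_idl//.
  exact: (fsubsetP (minbase_ground M L)).
have [I IM [IB <-]] := rk_basis M B => cI.
suff <- : I = B by [].
by apply/eqP; rewrite eqEfcard IB cI leqnn.
Qed.

Lemma card_minbase : #|` B| = rk M E.
Proof.
have [rkE _] := minbase_prefix (prefix_refl (by_load L E)).
by move: rkE; rewrite by_load_fset count_minbase.
Qed.

(* The prefix is spanned by its part lying in the minimum base, and that part
   together with D remains independent. *)
Lemma rk_keep_prefix D p : D `<=` B -> prefix p (by_load L E) ->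
  rk M (D `|` [fset x in p]) = #|` D| + count (mem (B `\` D)) p.
Proof.
move=> DB pre; have [rkP rkQ] := minbase_prefix pre.
have Up : uniq p by apply: prefix_uniq pre _; rewrite sort_uniq fset_uniq.
pose P := [fset x in p]; pose Q := [fset x in p | x \in B].
have QP : Q `<=` P by apply/fsubsetP => x; rewrite !inE => /andP[].
rewrite fsetUC -(rk_spanU D QP); last by rewrite rkP -rkQ.
rewrite rk_indep; last first.
  apply: indep_sub indep_minbase _; rewrite fsubUset DB andbT.
  by apply/fsubsetP => x; rewrite in_fset_cond => /andP[].
have <- : #|` Q `\` D| = count (mem (B `\` D)) p.
  rewrite -card_fset_count//; congr (#|` _|); apply/fsetP => x.
  rewrite in_fset_cond in_fsetD in_fset_cond. by rewrite andbCA -in_fsetD.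
have := cardfsID D Q; rewrite cardfsU.
lia.
Qed.

End OneMatroid.

(** * Effect of a deletion on one minimum base *)

Section Deletion.
Variables (M M' : matroid U) (e : U).
Hypotheses (ground_del : ground M' = ground M `\ e)
  (rk_del : forall A, A `<=` ground M' -> rk M' A = rk M A).

(** No element moves in front of [f], since the load of [f] is unchanged and the others do not drop.
    By [rkU1_sub] the smaller set of predecessors still does not span [f]. *)
Lemma minbase_del L L' f : (forall g, g \in ground M' -> L g <= L' g) ->
  f \in ground M' -> L' f = L f -> f \in minbase M L -> f \in minbase M' L'.
Proof.
move=> le fE' eqf; rewrite in_minbase => /andP[fE lt].
have sub : below (ground M') L' f `<=` below (ground M) L f.
  apply/fsubsetP => g; rewrite !in_below => /andP[gE' /andP[lgf ->]].
  move: (gE'); rewrite ground_del in_fsetD1 => /andP[_ ->] /=; rewrite andbT.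
  move: lgf (le _ gE'); rewrite /load_le eqf.
  move=> /orP[lt1 le1|/andP[/eqP -> og]]; first by rewrite (leq_ltn_trans le1).
  by rewrite leq_eqVlt og andbT orbC.
have bE' : below (ground M') L' f `<=` ground M'.
  by apply/fsubsetP => g; rewrite !in_below => /andP[].
rewrite in_minbase fE' /= !rk_del// ?fsubUset ?fsub1set ?fE'//.
exact: rkU1_sub sub lt.
Qed.

End Deletion.

(** * The greedy sequence of bases and its recourse *)

Definition load (bs : seq {fset U}) (f : U) := count (fun B => f \in B) bs.

Fixpoint greedy (M : matroid U) k : seq {fset U} :=
  if k is j.+1 then rcons (greedy M j) (minbase M (load (greedy M j)))
  else [::].

Lemma load_rcons bs B f : load (rcons bs B) f = load bs f + (f \in B).
Proof. by rewrite /load -cats1 count_cat /= addn0. Qed.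

Lemma size_greedy M k : size (greedy M k) = k.
Proof. by elim: k => //= k IH; rewrite size_rcons IH. Qed.

Lemma sum_load_greedy M k :
  \sum_(f <- ground M) load (greedy M k) f = k * rk M (ground M).
Proof.
elim: k => [|k IH] /=; first by rewrite big1_eq.
under eq_bigr do rewrite load_rcons.
rewrite big_split /= IH mulSn addnC; congr (_ + _).
rewrite -(card_minbase M (load (greedy M k))).
rewrite -(count_mem_fset (fset_uniq (ground M))); last first.
  exact/fsubsetP/minbase_ground.
by rewrite -sum1_count [RHS]big_mkcond; apply: eq_bigr => f _ /=; case: (f \in _).
Qed.

(** [C0] is meant for the updated element, which lies in only one of the two ground sets. *)
Definition changed E C0 (bs bs' : seq {fset U}) :=
  C0 `|` [fset f in E | load bs f != load bs' f].

Section DeletionRecourse.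
Variables (M M' : matroid U) (e : U).
Hypotheses (eM : e \in ground M) (ground_del : ground M' = ground M `\ e)
  (rk_del : forall A, A `<=` ground M' -> rk M' A = rk M A).

(** Where the loads agree, [minbase_del] puts [f] in the new base whenever it is in the old one;
    where they differ, one base changes each load by at most one and cannot reverse the
    inequality. *)
Lemma load_greedy_del k f : f \in ground M' ->
  load (greedy M k) f <= load (greedy M' k) f.
Proof.
move=> fE'; elim: k f fE' => [|k IH] f fE' //=; rewrite !load_rcons.
have := IH f fE'; rewrite leq_eqVlt => /orP[/eqP eqf|lt].
  rewrite eqf leq_add2l; case fB: (f \in minbase M _) => //.
  by rewrite (minbase_del ground_del rk_del IH fE' (esym eqf) fB).
by case: (f \in minbase M _); case: (f \in minbase M' _); lia.
Qed.

(** Every changed load rises by at least one. The new total is at most [k * rk M (ground M)], which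
    is the old total over [ground M'] plus the load of [e]; hence at most [k] loads change, and [e]
    adds one. *)
Lemma card_changed_del k :
  #|` changed (ground M') [fset e] (greedy M k) (greedy M' k)| <= k.+1.
Proof.
apply: leq_trans (leq_card_fsetU _ _) _; rewrite cardfs1 add1n ltnS.
rewrite card_fset_cond.
have := sum_load_greedy M' k; have := sum_load_greedy M k.
have -> : rk M' (ground M') = rk M (ground M') by rewrite rk_del.
have : rk M (ground M') <= rk M (ground M).
  by apply: rkS; rewrite ground_del fsubD1set.
rewrite (big_fsetD1 e)//= -ground_del => le_rk.
have : load (greedy M k) e <= k by rewrite -{2}(size_greedy M k) count_size.
rewrite -sum1_count /=.
have : \sum_(f <- ground M') (load (greedy M k) f +
      (if load (greedy M k) f != load (greedy M' k) f then 1 else 0)) <=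
    \sum_(f <- ground M') load (greedy M' k) f.
  rewrite big_seq [leqRHS]big_seq; apply: leq_sum => f fE'.
  have := load_greedy_del k fE'; case: eqVneq => [->|ne]; first by rewrite addn0.
  by move=> le; rewrite addn1 ltn_neqAle ne.
rewrite big_split /= => h1 h2 h3 h4.
have : k * rk M (ground M') <= k * rk M (ground M) by rewrite leq_mul2l le_rk orbT.
rewrite [\sum_(_ <- _ | _) 1]big_mkcond /=; lia.
Qed.

Let old k := minbase M (load (greedy M k)).
Let new k := minbase M' (load (greedy M' k)).
Let C k := changed (ground M') [fset e] (greedy M k) (greedy M' k).

Lemma minbase_changed_del k : old k `\` C k `<=` new k.
Proof.
apply/fsubsetP => f; rewrite in_fsetD !in_fsetU in_fset1 in_fset_cond negb_or.
move=> /andP[/andP[fe]]; rewrite negb_and negbK => eqf fold.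
have fE' : f \in ground M'.
  by rewrite ground_del in_fsetD1 fe (fsubsetP (minbase_ground M _) _ fold).
rewrite fE' /= in eqf.
apply: (minbase_del ground_del rk_del) fold => //; first exact: load_greedy_del.
by rewrite (eqP eqf).
Qed.

Lemma card_minbase_del k : #|` new k| <= #|` old k|.
Proof.
by rewrite !card_minbase rk_del// rkS// ground_del fsubD1set.
Qed.

(** As the new base is no larger than the old one, the missing part is no larger than what [C k]
    removes from the old base. *)
Lemma del_recourse k : #|` new k `\` (old k `\` C k)| <= k.+1.
Proof.
rewrite cardfsDS ?minbase_changed_del//.
have := card_changed_del k; have := card_minbase_del k.
have := cardfsID (C k) (old k).
have : #|` old k `&` C k| <= #|` C k| by apply/fsubset_leq_card/fsubsetIr.
rewrite -/(C k); lia.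
Qed.

(** For an insertion the roles swap: [M] is the matroid after the update, [new k] the stored base
    and [old k] the one sought. *)
Lemma ins_sub k : old k `<=` new k `|` C k.
Proof. by rewrite fsetUC -fsubDset minbase_changed_del. Qed.

Lemma ins_recourse k : #|` (new k `|` C k) `\` old k| <= k.+1.
Proof.
rewrite cardfsDS ?ins_sub//.
have := card_changed_del k; have := card_minbase_del k.
have := leq_of_leqif (leq_card_fsetU (new k) (C k)).
rewrite -/(C k); lia.
Qed.

End DeletionRecourse.
End MinimumBase.

(** * The algorithm *)

Section Programs.
Variable U : choiceType.
Implicit Types (A B C D E X Z : {fset U}) (p q s : seq U) (o : {fset U} -> nat).

Fixpoint bind (S T : Type) (P : query_prog U S) (k : S -> query_prog U T) :=
  match P with
  | Return x => k x
  | Query A h => Query A (fun a => bind (h a) k)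
  end.

Lemma result_bind S T (P : query_prog U S) (k : S -> query_prog U T) o :
  result o (bind P k) = result o (k (result o P)).
Proof. by elim: P => //= A h IH; rewrite IH. Qed.

Lemma queries_bind S T (P : query_prog U S) (k : S -> query_prog U T) o :
  queries o (bind P k) = queries o P ++ queries o (k (result o P)).
Proof. by elim: P => //= A h IH; rewrite IH. Qed.

(* Bisection for the members in s of an unknown set: np and ns are the numbers
   of members in p and p ++ s, and c q turns the rank of D `|` q into the number
   of members in q. *)
Fixpoint search D (c : seq U -> nat -> nat) d p np s ns : query_prog U (seq U) :=
  if np == ns then Return U [::] else
  if d is d'.+1 then
    let h := take (2 ^ d') s in
    Query (D `|` [fset x in p ++ h]) (fun a =>
      bind (search D c d' p np h (c (p ++ h) a)) (fun x =>
      bind (search D c d' (p ++ h) (c (p ++ h) a) (drop (2 ^ d') s) ns) (fun y =>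
      Return U (x ++ y))))
  else Return U s.

(** A query is made only on a block containing a member, so each member pays for at most one query
    per level. Only prefixes are queried, hence [c] need only be right on these. *)
Lemma search_correct D c d p s o (a : pred U) :
  (forall q, prefix q (p ++ s) -> c q (o (D `|` [fset x in q])) = count a q) ->
  size s <= 2 ^ d ->
  let P := search D c d p (count a p) s (count a (p ++ s)) in
  [/\ result o P = seq.filter a s, size (queries o P) <= count a s * d &
      forall A, A \in queries o P ->
        exists2 q, prefix q (p ++ s) & A = D `|` [fset x in q]].
Proof.
elim: d p s => [|d IH] p s cE sz /=.
all: rewrite count_cat; case: eqVneq => [/eqP|ne].
- rewrite -{1}(addn0 (count a p)) eqn_add2l => /eqP s0; split => //=.
  by apply/esym/eqP; rewrite -size_eq0 size_filter -s0.
(* At depth 0 the block has at most one element, and unequal counts say that it is a member. *)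
- split => //=; have : count a s == size s.
    move: ne sz; rewrite -{1}(addn0 (count a p)) eqn_add2l expn0.
    by have := count_size a s; lia.
  by rewrite -all_count => /all_filterP.
- rewrite -{1}(addn0 (count a p)) eqn_add2l => /eqP s0; split => //=.
  by apply/esym/eqP; rewrite -size_eq0 size_filter -s0.
set h := take _ s; set t := drop _ s.
have ht : h ++ t = s by apply: cat_take_drop.
have pre_h : prefix (p ++ h) (p ++ s) by rewrite -ht catA prefix_prefix.
rewrite /= cE// -count_cat.
have [||rh sh qh] := IH p h.
- by move=> q qp; apply: cE; apply: prefix_trans pre_h.
- by rewrite size_take; case: ifP => // /negbT; rewrite -leqNgt.
have [||rt st qt] := IH (p ++ h) t.
- by move=> q; rewrite -catA ht; apply: cE.
- by move: sz; rewrite size_drop expnS; lia.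
rewrite -catA ht in rt st qt.
rewrite !result_bind !queries_bind /= cats0 rh rt.
split => [|| A].
- by rewrite -seq.filter_cat ht.
- have ->: count a s = count a h + count a t by rewrite -count_cat ht.
  rewrite size_cat mulnS mulnDl.
  have : 0 < count a h + count a t.
    by rewrite -count_cat ht lt0n; apply: contra ne => /eqP ->; rewrite addn0.
  by move: sh st; lia.
rewrite inE mem_cat => /orP[/eqP ->|/orP[/qh[q qp ->]|/qt[q qp ->]]].
- by exists (p ++ h).
- by exists q => //; apply: prefix_trans pre_h.
- by exists q.
Qed.

Lemma count_fsetD X Z q : X `<=` Z ->
  count (mem Z) q = count (mem X) q + count (mem (Z `\` X)) q.
Proof.
move=> XZ; elim: q => //= x q ->; rewrite in_fsetD.
by have := fsubsetP XZ x; case: (x \in X) => [->//|_] /=; lia.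
Qed.

(** The first query finds the total number of members; it accounts for the successor in the query
    bounds. *)
Definition search_all D c d s :=
  Query (D `|` [fset x in s]) (fun a => search D c d [::] 0 s (c s a)).

Lemma search_all_correct D c d s o (a : pred U) :
  (forall q, prefix q s -> c q (o (D `|` [fset x in q])) = count a q) ->
  size s <= 2 ^ d ->
  let P := search_all D c d s in
  [/\ result o P = seq.filter a s, size (queries o P) <= (count a s * d).+1 &
      forall A, A \in queries o P -> A `<=` D `|` [fset x in s]].
Proof.
move=> cE sz /=; rewrite cE ?prefix_refl//.
have [r sq qs] := @search_correct D c d [::] s o a cE sz.
split => // A; rewrite inE => /orP[/eqP -> //|/qs[q /prefixP[t s_eq] ->]].
apply: fsetUS; apply/fsubsetP => x.
by rewrite !in_fset /= => xq; rewrite -[s]/([::] ++ s) s_eq mem_cat xq.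
Qed.

(** * Recomputing the bases after an update *)

Variables (ord : rel U).
Hypotheses (ord_total : total ord) (ord_anti : antisymmetric ord)
  (ord_trans : transitive ord).
Variable d : nat.

(* B is the old base and C the set of inserted, deleted or reweighted elements.
   After a deletion the new base contains B `\` C; after an insertion it is
   contained in B `|` C. Only the difference is searched for. *)
Definition next_base (ins : bool) E C L B : query_prog U {fset U} :=
  let s := by_load ord L E in
  if ins then
    let Z := B `|` C in
    bind (search_all fset0 (fun q a => count (mem Z) q - a) d s)
      (fun x => Return U (Z `\` [fset y in x]))
  else
    let D := B `\` C in
    bind (search_all D (fun _ a => a - #|` D|) d s)
      (fun x => Return U (D `|` [fset y in x])).

Definition guess_valid (ins : bool) E C B B' :=
  if ins then B' `<=` B `|` C /\ B `|` C `<=` E else B `\` C `<=` B'.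

Definition guess_error (ins : bool) C B B' :=
  #|` if ins then (B `|` C) `\` B' else B' `\` (B `\` C)|.

Lemma next_base_correct (M : matroid U) ins C L B :
  let E := ground M in let B' := minbase ord M L in
  #|` E| <= 2 ^ d -> guess_valid ins E C B B' ->
  let P := next_base ins E C L B in
  [/\ result (rk M) P = B',
      size (queries (rk M) P) <= (guess_error ins C B B' * d).+1 &
      forall A, A \in queries (rk M) P -> A `<=` E].
Proof.
move=> E B' szE; rewrite /guess_valid /guess_error /next_base.
set s := by_load ord L E.
have sE : [fset x in s] = E by apply: by_load_fset.
have Us : uniq s by rewrite sort_uniq fset_uniq.
have szs : size s <= 2 ^ d by rewrite size_sort.
have B'E : B' `<=` E by apply: minbase_ground.
case: ins => [[B'Z ZE]|DB'].
- set Z := B `|` C in B'Z ZE *.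
  (* The rank of a prefix counts its elements in [B'], so subtracting it from the count of [Z]
     leaves the elements to discard. *)
  have [q qs|//|] := @search_all_correct fset0 (fun q a => count (mem Z) q - a) d s
     (rk M) (mem (Z `\` B')).
    rewrite fset0U.
    have [-> _] := minbase_prefix ord_total ord_anti ord_trans qs.
    by rewrite (count_fsetD q B'Z) addKn.
  move=> r sq qs; rewrite result_bind queries_bind r cats0; split.
  + apply/fsetP => x; rewrite in_fsetD in_fset mem_filter /= in_fsetD.
    rewrite mem_by_load; have := fsubsetP B'Z x; have := fsubsetP ZE x.
    by move=> /implyP + /implyP; case: (x \in Z); case: (x \in E); case: (x \in B').
  + apply: leq_trans sq _; rewrite count_mem_fset// => x.
    by rewrite in_fsetD mem_by_load => /andP[_ /(fsubsetP ZE)].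
  + by move=> A /qs; rewrite fset0U sE.
- set D := B `\` C in DB' *.
  have [q qs|//|] := @search_all_correct D (fun q a => a - #|` D|) d s
     (rk M) (mem (B' `\` D)).
    by rewrite (rk_keep_prefix ord_total ord_anti ord_trans DB' qs) addKn.
  move=> r sq qs; rewrite result_bind queries_bind r cats0; split.
  + apply/fsetP => x; rewrite in_fsetU [x \in [fset _ in _]]in_fset mem_filter /= in_fsetD.
    rewrite mem_by_load; have := fsubsetP B'E x; have := fsubsetP DB' x.
    by move=> /implyP + /implyP; case: (x \in D); case: (x \in E); case: (x \in B').
  + apply: leq_trans sq _; rewrite count_mem_fset// => x.
    by rewrite in_fsetD mem_by_load => /andP[_ /(fsubsetP B'E)].
  + move=> A /qs; rewrite sE.
    by rewrite (fsetUidPr _ _ (fsubset_trans DB' B'E)).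
Qed.

(** [old] and [new] accumulate the stored and recomputed bases of earlier levels, whose loads
    determine the next base and the changed set. *)
Fixpoint rebuild ins E C0 (todo old new : seq {fset U}) :
    query_prog U (seq {fset U}) :=
  if todo is B :: todo' then
    bind (next_base ins E (changed E C0 old new) (load new) B) (fun B' =>
      rebuild ins E C0 todo' (rcons old B) (rcons new B'))
  else Return U new.

Lemma rebuild_correct (M : matroid U) ins C0 bs N :
  let E := ground M in let B' i := minbase ord M (load (greedy ord M i)) in
  let C i := changed E C0 (take i bs) (greedy ord M i) in
  #|` E| <= 2 ^ d ->
  (forall i, i < size bs ->
    guess_valid ins E (C i) (nth fset0 bs i) (B' i) /\
    guess_error ins (C i) (nth fset0 bs i) (B' i) <= N) ->
  let P := rebuild ins E C0 bs [::] [::] in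
  [/\ result (rk M) P = greedy ord M (size bs),
      size (queries (rk M) P) <= size bs * (N * d).+1 &
      forall A, A \in queries (rk M) P -> A `<=` E].
Proof.
move=> E B' C szE ok.
suff gen j i : i + j = size bs ->
    let P := rebuild ins E C0 (drop i bs) (take i bs) (greedy ord M i) in
    [/\ result (rk M) P = greedy ord M (size bs),
        size (queries (rk M) P) <= j * (N * d).+1 &
        forall A, A \in queries (rk M) P -> A `<=` E].
  by have := gen (size bs) 0 erefl; rewrite drop0 take0.
elim: j i => [|j IH] i; first by rewrite addn0 => ->; rewrite drop_size.
move=> ij; have lt_i : i < size bs by lia.
rewrite (drop_nth fset0)//=.
have [val err] := ok i lt_i.
have [r sq qs] := next_base_correct szE val.
have [|r' sq' qs'] := IH i.+1; first by lia.
rewrite result_bind queries_bind r -(take_nth fset0)//.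
split => //.
- rewrite size_cat mulSn leq_add//; apply: leq_trans sq _.
  by rewrite ltnS leq_mul2r err orbT.
- by move=> A; rewrite mem_cat => /orP[/qs|/qs'].
Qed.

Lemma take_greedy (M : matroid U) k i : i <= k ->
  take i (greedy ord M k) = greedy ord M i.
Proof.
elim: k => [|k IH]; first by rewrite leqn0 => /eqP ->.
rewrite leq_eqVlt => /orP[/eqP ->|lt]; first by rewrite take_oversize ?size_greedy.
by rewrite /= -cats1 takel_cat ?size_greedy//; apply: IH.
Qed.

Lemma nth_greedy (M : matroid U) k i : i < k ->
  nth fset0 (greedy ord M k) i = minbase ord M (load (greedy ord M i)).
Proof.
elim: k => //= k IH; rewrite ltnS nth_rcons size_greedy leq_eqVlt.
by move=> /orP[/eqP ->|lt]; rewrite ?ltnn ?eqxx// lt IH.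
Qed.

Definition is_deletion (M M' : matroid U) e :=
  [/\ e \in ground M, ground M' = ground M `\ e &
    forall A, A `<=` ground M' -> rk M' A = rk M A].

Lemma rebuild_deletion (M M' : matroid U) e k : is_deletion M M' e ->
  #|` ground M'| <= 2 ^ d ->
  let P := rebuild false (ground M') [fset e] (greedy ord M k) [::] [::] in
  [/\ result (rk M') P = greedy ord M' k,
      size (queries (rk M') P) <= k * (k * d).+1 &
      forall A, A \in queries (rk M') P -> A `<=` ground M'].
Proof.
move=> [eM gM' rkM'] szE.
have [i|] := @rebuild_correct M' false [fset e] (greedy ord M k) k szE; last first.
  by rewrite size_greedy.
rewrite size_greedy => ik; rewrite (take_greedy _ (ltnW ik)) (nth_greedy _ ik); split.
  exact: minbase_changed_del.
by apply: leq_trans ik; apply: del_recourse.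
Qed.

Lemma changed_insertion (M M' : matroid U) e bs bs' :
  ground M' = ground M `\ e ->
  changed (ground M) [fset e] bs' bs = changed (ground M') [fset e] bs bs'.
Proof.
move=> gM'; apply/fsetP => x; rewrite !in_fsetU !in_fset_cond gM' /=.
rewrite !in_fset1 in_fsetD1 [load bs' x == _]eq_sym.
by case: (x == e).
Qed.

Lemma rebuild_insertion (M M' : matroid U) e k : is_deletion M M' e ->
  #|` ground M| <= 2 ^ d ->
  let P := rebuild true (ground M) [fset e] (greedy ord M' k) [::] [::] in
  [/\ result (rk M) P = greedy ord M k,
      size (queries (rk M) P) <= k * (k * d).+1 &
      forall A, A \in queries (rk M) P -> A `<=` ground M].
Proof.
move=> [eM gM' rkM'] szE.
have [i|] := @rebuild_correct M true [fset e] (greedy ord M' k) k szE; last first.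
  by rewrite size_greedy.
rewrite size_greedy => ik; rewrite (take_greedy _ (ltnW ik)) (nth_greedy _ ik).
have sM : ground M' `<=` ground M by rewrite gM' fsubD1set.
rewrite (changed_insertion _ _ gM'); split; last first.
  by apply: leq_trans ik; apply: ins_recourse.
split; first exact: ins_sub.
rewrite !fsubUset fsub1set eM (fsubset_trans (minbase_ground _ _ _))//=.
by apply: fsubset_trans sM; apply: fset_sub.
Qed.

(** The empty set is a valid guess for every base, so initialisation runs the same program as a
    deletion. *)
Lemma rebuild_scratch (M : matroid U) k : #|` ground M| <= 2 ^ d ->
  let P := rebuild false (ground M) fset0 (nseq k fset0) [::] [::] in
  result (rk M) P = greedy ord M k /\
  (forall A, A \in queries (rk M) P -> A `<=` ground M).
Proof.
move=> szE.
have [i|] := @rebuild_correct M false fset0 (nseq k fset0) #|` ground M| szE; last first.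
  by rewrite size_nseq.
rewrite size_nseq => ik; rewrite nth_nseq ik /guess_valid /guess_error fset0D.
rewrite fsub0set fsetD0; split => //.
exact/fsubset_leq_card/minbase_ground.
Qed.

(** All sets gained by an insertion contain [e], so ranks of sets avoiding [e] are unchanged and the
    old matroid is a deletion of the new one. *)
Lemma update_spec_deletion (u : update U) (M M' : matroid U) :
  update_spec u M M' ->
  match u with
  | Insert e => ground M' = e |` ground M /\ is_deletion M' M e
  | Delete e => ground M' = ground M `\ e /\ is_deletion M M' e
  end.
Proof.
case: u => e /= [eM gM'].
- move=> [Ie eIe iM']; split=> //.
  have gM : ground M = ground M' `\ e.
    by rewrite gM' fsetU1K.
  split; rewrite ?gM' ?fset1U1 -?gM' // => A AM.
  apply/eqP; rewrite eqn_leq; apply/andP; split.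
    have [I IM [IA <-]] := rk_basis M A.
    by apply: indep_le_rk => //; rewrite iM' in_fsetU IM.
  have [I IM' [IA <-]] := rk_basis M' A.
  apply: indep_le_rk => //; move: IM'; rewrite iM' in_fsetU.
  by move=> /orP[//|/eIe/(fsubsetP IA)/(fsubsetP AM)]; rewrite (negPf eM).
- move=> iM'; split=> //; split => // A; rewrite gM' => AM'.
  apply/eqP; rewrite eqn_leq; apply/andP; split.
    have [I IM' [IA <-]] := rk_basis M' A.
    apply: indep_le_rk => //; move: IM'; rewrite iM' in_fset_cond.
    by case/andP.
  have [I IM [IA <-]] := rk_basis M A.
  apply: indep_le_rk => //; rewrite iM' in_fset_cond.
  by apply/andP; split; rewrite // (fsubset_trans IA).
Qed.

(** * The dynamic algorithm and its invariant *)

Section Algorithm.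
Variables (V : Type) (k : nat) (out : {fset U} -> seq {fset U} -> V).

Definition tag_ground E P : query_prog U ({fset U} * seq {fset U}) :=
  bind P (fun bs => Return U (E, bs)).

Definition greedy_algorithm : dyn_algorithm V U :=
  DynAlgorithm
    (fun E => tag_ground E (rebuild false E fset0 (nseq k fset0) [::] [::]))
    (fun u st =>
      match u with
      | Insert e =>
          tag_ground (e |` st.1) (rebuild true (e |` st.1) [fset e] st.2 [::] [::])
      | Delete e =>
          tag_ground (st.1 `\ e) (rebuild false (st.1 `\ e) [fset e] st.2 [::] [::])
      end)
    (fun st => out st.1 st.2).

Lemma greedy_algorithm_correct T (M : nat -> matroid U) (u : nat -> update U) :
  dynamic_matroid T M u ->
  (forall t, t <= T -> #|` ground (M t)| <= 2 ^ d) ->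
  forall t, t <= T ->
    [/\ output_at greedy_algorithm M u t =
          out (ground (M t)) (greedy ord (M t) k),
        (forall A, A \in queries_at greedy_algorithm M u t ->
          A `<=` ground (M t)) &
        0 < t -> size (queries_at greedy_algorithm M u t) <= k * (k * d).+1].
Proof.
move=> dyn sz t tT.
suff [eq_st sub bnd] : [/\ state_at greedy_algorithm M u t =
          (ground (M t), greedy ord (M t) k),
        (forall A, A \in queries_at greedy_algorithm M u t ->
          A `<=` ground (M t)) &
        0 < t -> size (queries_at greedy_algorithm M u t) <= k * (k * d).+1].
  by split=> //; rewrite /output_at eq_st.
elim: t tT => [|t IH] tT.
  have [r qs] := rebuild_scratch k (sz 0 tT).
  split=> [|A|//]; first by rewrite /= /tag_ground result_bind r.
  by rewrite /queries_at /= /tag_ground queries_bind cats0; apply: qs.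
have [eq_st _ _] := IH (ltnW tT).
have := update_spec_deletion (dyn t tT).
rewrite /queries_at /= -/(state_at greedy_algorithm M u) eq_st.
case: (u t) => e /= [<- del].
- have [r sq qs] := rebuild_insertion k del (sz _ tT).
  by rewrite /tag_ground result_bind queries_bind cats0 r.
- have [r sq qs] := rebuild_deletion k del (sz _ tT).
  by rewrite /tag_ground result_bind queries_bind cats0 r.
Qed.

End Algorithm.
End Programs.

(** * Approximation guarantee *)

Local Open Scope ring_scope.

(** * The fractional covering number *)

Section FractionalCovering.
Variables (R : realType) (U : choiceType) (M : matroid U).
Let E := ground M.

Lemma fractional_covering_ge0 : (0 <= fractional_covering R M)%E.
Proof. exact: bigmax_ge_id. Qed.

Lemma fractional_covering_set0 : E = fset0 -> fractional_covering R M = 0%E.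
Proof.
rewrite /fractional_covering -/E => ->.
rewrite big_seq_cond big_pred0// => A.
by rewrite fpowerset0 in_fset1; case: eqVneq.
Qed.

Lemma fractional_covering_ub A : A `<=` E -> A != fset0 ->
  ((#|` A|%:R)%:E / ((rk M A)%:R)%:E <= fractional_covering R M)%E.
Proof.
move=> AE A0; rewrite /fractional_covering.
apply: (le_bigmax_seq 0%E A (fun A => A != fset0)
  (fun A => ((#|` A|%:R)%:E / ((rk M A)%:R)%:E)%E)) => //.
by rewrite fpowersetE.
Qed.

Lemma fractional_covering_attained : E != fset0 ->
  exists A, [/\ A `<=` E, A != fset0 &
    fractional_covering R M = ((#|` A|%:R)%:E / ((rk M A)%:R)%:E)%E].
Proof.
move=> E0.
(* The maximum may come from its default 0; then [E] attains it as well, its ratio being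
   nonnegative. *)
have : fractional_covering R M = 0%E \/
    exists A, [/\ A `<=` E, A != fset0 &
      fractional_covering R M = ((#|` A|%:R)%:E / ((rk M A)%:R)%:E)%E].
  rewrite /fractional_covering big_seq_cond.
  elim/big_ind: _ => [|x y hx hy|A /andP[AE A0]]; first by left.
    by case: (leP x y).
  by right; exists A; rewrite -fpowersetE.
case=> [fc0|//]; exists E; split => //.
apply/eqP; rewrite eq_le fractional_covering_ub// andbT fc0 mule_ge0//.
by rewrite inve_ge0.
Qed.

Lemma fractional_covering_le (b : R) A :
  fractional_covering R M = b%:E -> A `<=` E -> #|` A|%:R <= b * (rk M A)%:R.
Proof.
move=> fcb AE; have [->|A0] := eqVneq A fset0.
  have := rk_le_card M fset0; rewrite cardfs0 leqn0 => /eqP ->.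
  by rewrite mulr0.
have : ((#|` A|%:R)%:E / ((rk M A)%:R)%:E <= b%:E)%E.
  by rewrite -fcb fractional_covering_ub.
rewrite inver; case: ifP => [_|rk0].
  by rewrite gt0_muley ?lte_fin ?ltr0n ?cardfs_gt0// leNgt ltry.
rewrite -EFinM lee_fin ler_pdivrMr// lt_neqAle eq_sym rk0 /=.
exact: ler0n.
Qed.

(* A finite covering number excludes loops, so the densest set has positive
   rank and the quotient defining its density is not junk. *)
Lemma fractional_covering_eq (b : R) : fractional_covering R M = b%:E ->
  E != fset0 ->
  exists A, [/\ A `<=` E, (0 < rk M A)%N & #|` A|%:R = b * (rk M A)%:R].
Proof.
move=> fcb /fractional_covering_attained[A [AE A0]].
rewrite fcb inver; case: ifP => [_|rk0].
  by rewrite gt0_muley ?lte_fin ?ltr0n ?cardfs_gt0.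
rewrite -EFinM => -[->]; exists A; split => //.
  by rewrite lt0n; move: rk0; rewrite pnatr_eq0 => ->.
by rewrite divfK ?rk0.
Qed.

Lemma fractional_covering_ge1 (b : R) : fractional_covering R M = b%:E ->
  E != fset0 -> 1 <= b.
Proof.
move=> fcb /(fractional_covering_eq fcb)[A [AE rk0 cA]].
have : (rk M A)%:R <= #|` A|%:R :> R by rewrite ler_nat rk_le_card.
by rewrite cA -ler_pdivrMr ?ltr0n// divff// pnatr_eq0 -lt0n.
Qed.

End FractionalCovering.

(** * Exponential potential of the loads *)

Section PotentialAnalysis.
Variables (R : realType) (U : choiceType) (ord : rel U).
Hypotheses (ord_total : total ord) (ord_anti : antisymmetric ord)
  (ord_trans : transitive ord).

Lemma sumr1_size (q : seq U) : \sum_(f <- q) 1 = (size q)%:R :> R.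
Proof. by rewrite -sum1_size natr_sum. Qed.

(** Abel summation. In the induction [c] is the sum of [x] over the part already consumed and [w0] a
    bound on the weights to come; lowering [w0] to the next weight loses a nonnegative amount. *)
Lemma abel_sum_ge0 (s : seq U) (x w : U -> R) c w0 : 0 <= c ->
  pairwise (fun f g => w g <= w f) s -> all (fun f => 0 <= w f <= w0) s ->
  (forall q, prefix q s -> 0 <= c + \sum_(f <- q) x f) ->
  0 <= w0 -> 0 <= c * w0 + \sum_(f <- s) x f * w f.
Proof.
elim: s c w0 => [|f s IH] c w0 c0 /=.
  by move=> *; rewrite big_nil addr0 mulr_ge0.
move=> /andP[wf ws] /andP[/andP[wf0 wfw0] all0] pre w00.
have cf : 0 <= c + x f.
  by have := pre [:: f]; rewrite /= eqxx prefix0s big_seq1; apply.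
have IHf : 0 <= (c + x f) * w f + \sum_(g <- s) x g * w g.
  apply: IH => //.
    apply/allP => g gs; rewrite (allP wf)//.
    by case/andP: (allP all0 _ gs) => ->.
  by move=> q qs; have := pre (f :: q); rewrite /= eqxx qs big_cons addrA; apply.
rewrite big_cons; have : 0 <= c * (w0 - w f) by rewrite mulr_ge0// subr_ge0.
lra.
Qed.

Section OneMatroid.
Variables (M : matroid U) (b : R).
Let E := ground M.
Hypothesis card_le : forall A, A `<=` E -> #|` A|%:R <= b * (rk M A)%:R.

(** A prefix [q] in load order satisfies [|q| <= b * rk q = b * |B & q|], so [b * [f in B] - 1] has
    nonnegative prefix sums. Abel summation applies because the weights decrease along the order. *)
Lemma minbase_weight (L : U -> nat) (w : nat -> R) :
  (forall i, 0 <= w i) -> {homo w : i j / (i <= j)%N >-> j <= i} ->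
  \sum_(f <- E) w (L f) <=
  b * \sum_(f <- E) (f \in minbase ord M L)%:R * w (L f).
Proof.
move=> w0 wS; set B := minbase ord M L.
pose x f : R := b * (f \in B)%:R - 1.
have : 0 <= 0 * w 0%N + \sum_(f <- by_load ord L E) x f * w (L f).
  apply: abel_sum_ge0 => //.
  - have : pairwise (load_le ord L) (by_load ord L E).
      rewrite -(sorted_pairwise (@load_le_trans _ _ ord_trans L)).
      exact: sort_sorted (@load_le_total _ _ ord_total L) _.
    apply: sub_pairwise => f g /orP[/ltnW|/andP[/eqP -> _]]; last by [].
    exact: wS.
  - by apply/allP => f _; rewrite w0 wS.
  - move=> q qs; have [rkq _] := minbase_prefix ord_total ord_anti ord_trans qs.
    have Uq : uniq q by apply: prefix_uniq qs _; rewrite sort_uniq fset_uniq.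
    have qE : [fset f in q] `<=` E.
      apply/fsubsetP => f; rewrite in_fset /= => fq.
      rewrite -(mem_by_load ord L); have /prefixP[t ->] := qs.
      by rewrite mem_cat fq.
    have := card_le qE; rewrite rkq card_fseq undup_id// => le.
    rewrite add0r sumrB -mulr_sumr -natr_sum.
    have -> : (\sum_(f <- q) (f \in B) = count (mem B) q)%N.
      by rewrite -sum1_count [RHS]big_mkcond.
    by rewrite sumr1_size subr_ge0.
rewrite mul0r add0r (perm_big E) ?perm_sort//=.
under eq_bigr do rewrite mulrBl mul1r -mulrA.
by rewrite sumrB -mulr_sumr subr_ge0.
Qed.

Hypothesis b_ge1 : 1 <= b.

(** A new base lowers the potential by [1 - q] times its weight, hence scales it by at most [1 - (1
    - q) / b <= expR (- ((1 - q) / b))]. *)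
Lemma potential_greedy (q : R) k : 0 <= q <= 1 ->
  \sum_(f <- E) q ^+ load (greedy ord M k) f <=
  #|` E|%:R * expR (- (k%:R * ((1 - q) / b))).
Proof.
move=> /andP[q0 q1]; elim: k => [|k IH].
  rewrite mul0r oppr0 expR0 mulr1; under eq_bigr do rewrite expr0.
  by rewrite sumr1_size.
have := minbase_weight (load (greedy ord M k)) (w := fun i => q ^+ i).
set B := minbase _ _ _; set L := load (greedy ord M k) in IH B * => mw.
have {mw} le : \sum_(f <- E) q ^+ L f <= b * \sum_(f <- E) (f \in B)%:R * q ^+ L f.
  apply: mw => [i|i j ij]; first exact: exprn_ge0.
  exact: ler_wiXn2l.
have -> : \sum_(f <- E) q ^+ load (greedy ord M k.+1) f =
    \sum_(f <- E) q ^+ L f - (1 - q) * \sum_(f <- E) (f \in B)%:R * q ^+ L f.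
  rewrite mulr_sumr -sumrB; apply: eq_bigr => f _ /=.
  rewrite load_rcons -/L -/B exprD; case: (f \in B) => /=.
    by rewrite expr1 mul1r mulrBl mul1r subKr mulrC.
  by rewrite expr0 mul0r mulr0 subr0 mulr1.
set S := \sum_(f <- E) q ^+ L f in IH le *.
set W := \sum_(f <- E) _ in le *.
have b0 : 0 < b by apply: lt_le_trans b_ge1.
have S0 : 0 <= S by apply: sumr_ge0 => f _; apply: exprn_ge0.
apply: (@le_trans _ _ (S * (1 - (1 - q) / b))).
  have SW : S / b <= W by rewrite ler_pdivrMr// mulrC.
  rewrite mulrBr mulr1 lerD2l lerN2 mulrCA; apply: ler_wpM2l => //.
  by rewrite subr_ge0.
rewrite -natr1 (mulrDl _ _ ((1 - q) / b)) mul1r opprD expRD mulrA.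
apply: ler_pM => //; last exact: expR_ge1Dx.
(* The scaling factor is nonnegative because [1 - q <= 1 <= b]. *)
rewrite subr_ge0 ler_pdivrMr// mul1r.
by apply: le_trans b_ge1; rewrite lerBlDr lerDl.
Qed.

(** With [q = 1 / (1 + d)], the term of [f] alone is at most the potential and at least
    [expR (- (d * load))]; take logarithms. *)
Lemma load_greedy_lower (d : R) n k f : 0 < d -> (#|` E| <= n)%N -> f \in E ->
  k%:R * d / (1 + d) <=
  b * (ln n%:R + d * (load (greedy ord M k) f)%:R).
Proof.
move=> d0 En fE; set m := load _ f.
have b0 : 0 < b by apply: lt_le_trans b_ge1.
have n0 : (0 < n)%N by apply: leq_trans En; rewrite cardfs_gt0; apply/fset0Pn; exists f.
pose q := (1 + d)^-1.
have q01 : 0 <= q <= 1 by rewrite invr_ge0 invf_le1; lra.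
have : q ^+ m <= n%:R * expR (- (k%:R * ((1 - q) / b))).
  apply: le_trans (_ : #|` E|%:R * _ <= _); last first.
    by apply: ler_wpM2r; rewrite ?expR_ge0// ler_nat.
  apply: le_trans (potential_greedy k q01).
  rewrite (big_fsetD1 f)//= lerDl; apply: sumr_ge0 => g _.
  by apply: exprn_ge0; case/andP: q01.
have : expR (- (d * m%:R)) <= q ^+ m.
  rewrite -mulNr expRM_natr; apply: lerXn2r; rewrite ?nnegrE ?expR_ge0//.
    by case/andP: q01.
  rewrite expRN lef_pV2 ?posrE ?expR_gt0//; [exact: expR_ge1Dx|lra].
move=> le1 le2; have := le_trans le1 le2.
rewrite -[n%:R]lnK ?posrE ?ltr0n// -expRD ler_expR => le3.
have d1 : 1 + d != 0 by rewrite gt_eqF// ltr_wpDr// ltW.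
have q_eq : 1 - q = d / (1 + d).
  by rewrite -[X in X - q](divff d1) /q -[X in _ - X]mul1r -mulrBl addrC addKr.
have -> : k%:R * d / (1 + d) = b * (k%:R * ((1 - q) / b)).
  by rewrite mulrCA [b * _]mulrC divfK ?gt_eqF// q_eq mulrA.
rewrite ler_pM2l//.
by move: le3; rewrite expRK lerBrDr addrC lerBlDr.
Qed.

End OneMatroid.

(** Each base meets [A] in an independent set. *)
Lemma sum_load_greedy_le (M : matroid U) k (A : {fset U}) :
  (\sum_(f <- A) load (greedy ord M k) f <= k * rk M A)%N.
Proof.
elim: k => [|k IH] /=; first by rewrite big1_eq.
under eq_bigr do rewrite load_rcons.
rewrite big_split /= mulSn addnC leq_add//.
set B := minbase _ _ _.
apply: leq_trans (_ : #|` A `&` B| <= _)%N; last first.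
  apply: indep_le_rk; last exact: fsubsetIl.
  apply: indep_sub (indep_minbase ord_total ord_anti ord_trans M _) _.
  exact: fsubsetIr.
rewrite -(count_mem_fset (fset_uniq A)); last exact/fsubsetP/fsubsetIl.
rewrite -sum1_count [leqRHS]big_mkcond big_seq [leqRHS]big_seq; apply: leq_sum => f fA /=.
by rewrite in_fsetI fA /=; case: (f \in B).
Qed.

End PotentialAnalysis.

(** * The estimate and the query count *)

Section Estimate.
Variables (R : realType) (U : choiceType).

(** The default [size bs] is neutral, as no load exceeds it. *)
Definition min_load (E : {fset U}) (bs : seq {fset U}) : nat :=
  \big[minn/size bs]_(f <- E) load bs f.

Lemma min_load_le E bs f : f \in E -> (min_load E bs <= load bs f)%N.
Proof.
rewrite /min_load => fE; have : f \in enum_fset E by [].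
elim: (enum_fset E) => //= g s IH.
rewrite inE big_cons => /orP[/eqP ->|/IH]; rewrite geq_min ?leqnn// => ->.
by rewrite orbT.
Qed.

Lemma min_load_attained E bs : E != fset0 ->
  exists2 f, f \in E & load bs f = min_load E bs.
Proof.
move=> /fset0Pn[f fE]; have le_f := min_load_le bs fE.
have : min_load E bs = size bs \/ exists2 f, f \in E & load bs f = min_load E bs.
  rewrite /min_load big_seq.
  elim/big_ind: _ => [|x y hx hy|g gE]; first by left.
    by case: (leqP x y).
  by right; exists g.
case=> // min_eq; exists f => //; apply/eqP; rewrite eqn_leq le_f andbT min_eq.
exact: count_size.
Qed.

(** The factor 16 gives [b * ln n <= k * (eps / 4) ^+ 2]. For [n <= 1] the query bound is 0, so no
    base is kept. *)
Definition num_bases (eps bmax : R) n : nat :=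
  if (n <= 1)%N then 0%N else (Num.truncn (16 * bmax * ln n%:R / eps ^+ 2)).+1.

Definition estimate n (E : {fset U}) (bs : seq {fset U}) : R :=
  if E == fset0 then 0 else
  if (n <= 1)%N then 1 else (size bs)%:R / (min_load E bs)%:R.

(** With [e = eps / 4] and [y = b * m], the hypotheses give [K * (1 - e - e ^+ 2) <= (1 + e) * y],
    and [(1 - e - e ^+ 2) * (1 + 4 * e) >= 1 + e] as [e < 1 / 8]. *)
Lemma estimate_upper_arith (eps b l K m : R) : 0 < eps -> eps < 1 / 2 ->
  0 <= K -> 0 <= m -> 0 <= b -> 16 * (b * l) <= K * eps ^+ 2 ->
  K * (eps / 4) / (1 + eps / 4) <= b * (l + eps / 4 * m) ->
  K <= (1 + eps) * b * m.
Proof.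
move=> eps0 eps2 K0 m0 b0; pose e := eps / 4.
have eE : eps = 4 * e by rewrite /e; lra.
rewrite -/e eE => h1.
have e0 : 0 < e by rewrite /e; lra.
have e8 : e < 1 / 8 by rewrite /e; lra.
rewrite ler_pdivrMr; last by lra.
set y := b * m; have y0 : 0 <= y by rewrite mulr_ge0.
move=> h2.
have h3 : b * l <= K * e ^+ 2 by move: h1; rewrite exprMn; lra.
have h4 : K * e <= (K * e ^+ 2 + e * y) * (1 + e).
  apply: (le_trans h2); apply: ler_wpM2r; first lra.
  by rewrite mulrDr lerD// mulrCA.
have h5 : K <= (K * e + y) * (1 + e).
  rewrite -(ler_pM2r e0); apply: le_trans h4 _; rewrite le_eqVlt; apply/orP; left.
  by apply/eqP; ring.
have h6 : 0 <= K * (e * (2 - 5 * e - 4 * e ^+ 2)).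
  apply: mulr_ge0 => //; apply: mulr_ge0; first exact: ltW.
  have : e ^+ 2 <= e * (1 / 8) by rewrite expr2 ler_pM2l// ltW.
  lra.
have h7 : K * (1 - e - e ^+ 2) * (1 + 4 * e) <= (1 + e) * y * (1 + 4 * e).
  by apply: ler_wpM2r; lra.
have h8 : 0 < 1 + e by lra.
rewrite -(ler_pM2r h8).
have -> : (1 + 4 * e) * b * m * (1 + e) = (1 + e) * y * (1 + 4 * e).
  by rewrite /y; ring.
apply: le_trans h7.
rewrite -subr_ge0.
have -> : K * (1 - e - e ^+ 2) * (1 + 4 * e) - K * (1 + e) =
  K * (e * (2 - 5 * e - 4 * e ^+ 2)) by ring.
by [].
Qed.

Variable ord : rel U.
Hypotheses (ord_total : total ord) (ord_anti : antisymmetric ord)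
  (ord_trans : transitive ord).

Lemma estimate_correct (M : matroid U) (eps b bmax : R) n :
  0 < eps -> eps < 1 / 2 -> (#|` ground M| <= n)%N ->
  fractional_covering R M = b%:E -> b <= bmax ->
  let x := estimate n (ground M) (greedy ord M (num_bases eps bmax n)) in
  (1 - eps) * b <= x /\ x <= (1 + eps) * b.
Proof.
move=> eps0 eps2 En fcb bb; set E := ground M in En *.
rewrite /= /estimate; case: eqVneq => [E0|E0].
  by move: fcb; rewrite fractional_covering_set0// => -[<-]; rewrite !mulr0.
have b1 : 1 <= b by apply: fractional_covering_ge1 fcb E0.
have b0 : 0 < b by apply: lt_le_trans b1.
have [A [AE rkA cA]] := fractional_covering_eq fcb E0.
have epsb : 0 < eps * b by apply: mulr_gt0.
rewrite /num_bases; case: ifP => n1.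
  (* The densest set is a single element of rank 1, so [b = 1], the value returned. *)
  have A_1 : (#|` A| <= 1)%N.
    by apply: leq_trans n1; apply: leq_trans En; apply: fsubset_leq_card.
  have rk1 : rk M A = 1%N.
    by apply/eqP; rewrite eqn_leq rkA andbT (leq_trans (rk_le_card M A)).
  have A1 : #|` A| = 1%N.
    by apply/eqP; rewrite eqn_leq A_1 -[X in (X <= _)%N]rk1 rk_le_card.
  by move: cA; rewrite A1 rk1 mulr1 => <-; lra.
rewrite ?n1; set k := (Num.truncn _).+1; set x0 := 16 * bmax * _ / _ in k *.
rewrite size_greedy; set m := min_load _ _.
have n0 : (0 < n)%N by move: n1; rewrite leqNgt => /negbFE/ltnW.
have l0 : 0 <= ln n%:R :> R by rewrite ln_ge0// ler1n.
have k0 : 0 < k%:R :> R by rewrite ltr0n.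
have x0k : x0 < k%:R by apply: truncnS_gt.
have [f fE mE] := min_load_attained (greedy ord M k) E0.
have e0 : 0 < eps / 4 by lra.
have low := load_greedy_lower ord_total ord_anti ord_trans
   (fun A => fractional_covering_le (A := A) fcb) b1 k e0 En fE.
have hK : 16 * (b * ln n%:R) <= k%:R * eps ^+ 2.
  apply: le_trans (_ : x0 * eps ^+ 2 <= _); last first.
    by rewrite ler_pM2r ?exprn_gt0// ltW.
  rewrite divfK ?expf_neq0 ?gt_eqF// -mulrA ler_pM2l// ler_wpM2r//.
have up : k%:R <= (1 + eps) * b * m%:R.
  apply: estimate_upper_arith hK _ => //; first exact: ltW.
  by move: low; rewrite mE.

(* As [k] is positive, [up] forces every element to be covered, so the quotient [k / m] is
   genuine. *)
have m0 : 0 < m%:R :> R.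
  have : 0 < (1 + eps) * b * m%:R by apply: lt_le_trans up.
  by rewrite pmulr_rgt0// mulr_gt0//; lra.
split; last by rewrite ler_pdivrMr.
(* The estimate is never below [b]: [m * |A| <= k * rk A] by summing loads over the densest set
   [A]. *)
apply: (@le_trans _ _ b); first by lra.
rewrite ler_pdivlMr//.
have rk0 : 0 < (rk M A)%:R :> R by rewrite ltr0n.
rewrite -(ler_pM2r rk0) mulrAC -cA -!natrM ler_nat.
apply: leq_trans (sum_load_greedy_le ord_total ord_anti ord_trans M k A).
rewrite -sum1_size big_distrl /= big_seq [leqRHS]big_seq; apply: leq_sum => g gA.
by rewrite mul1n min_load_le// (fsubsetP AE).
Qed.

Lemma ln2_ge : 1 / 2 <= ln 2 :> R.
Proof.
rewrite -[leLHS]expRK ler_ln ?posrE ?expR_gt0//.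
have : 1 / 2 <= expR (- (1 / 2)) :> R.
  by apply: le_trans (expR_ge1Dx _); lra.
rewrite expRN -lef_pV2 ?posrE ?invr_gt0 ?expR_gt0// invrK => /le_trans; apply.
by rewrite div1r invrK.
Qed.

(** With [y = bmax * l / eps ^+ 2], one has [k <= 32 * y] and [k * d + 1 <= 6 * k * l]; the constant
    is [6144 = 32 * 32 * 6]. *)
Lemma num_queries_le (eps bmax : R) n : 0 < eps -> eps < 1 / 2 -> 1 <= bmax ->
  (1 < n)%N ->
  (num_bases eps bmax n * (num_bases eps bmax n * up_log 2 n).+1)%:R <=
  6144 * (bmax ^+ 2 * eps ^- 4 * ln n%:R ^+ 3).
Proof.
move=> eps0 eps2 b1 n1; set k := num_bases eps bmax n.
set d := up_log 2 n; set l := ln n%:R.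
have l2 : 1 / 2 <= l.
  by apply: le_trans ln2_ge _; rewrite ler_ln ?posrE ?ltr0n ?ler_nat// ltnW.
have dl : d%:R <= 4 * l.
  have d0 : (0 < d)%N by rewrite up_log_gt0 n1.
  have : d.-1%:R * ln 2 <= l.
    rewrite mulr_natl -lnXn//; rewrite ler_ln ?posrE ?exprn_gt0 ?ltr0n//; last lia.
    by rewrite -natrX ler_nat ltnW// up_log_gtn.
  have : d%:R = d.-1%:R + 1 :> R by rewrite natr1 prednK.
  have := ln2_ge; have : 0 <= d.-1%:R :> R by [].
  move: (ln 2) (d.-1%:R) => c x x0 c2 -> xc.
  have : x * (1 / 2) <= x * c by apply: ler_wpM2l.
  lra.
pose y := bmax * l * eps ^- 2.
have b0 : 0 < bmax by apply: lt_le_trans b1.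
have l0 : 0 < l by lra.
have y0 : 0 < y by rewrite !mulr_gt0// invr_gt0 exprn_gt0.
have bl : 1 / 2 <= bmax * l.
  by apply: le_trans l2 _; rewrite ler_peMl// ltW.
have y1 : 1 / 2 <= y.
  apply: le_trans bl _; rewrite /y ler_peMr ?mulr_ge0 ?ltW//.
  rewrite invf_gt1 ?exprn_gt0// expr2.
  have : eps * eps < 1 * 1 by apply: ltr_pM => //; lra.
  by rewrite mulr1.
(* The successor after truncation is absorbed because [y >= 1 / 2]. *)
have ky : k%:R <= 32 * y.
  rewrite /k /num_bases leqNgt n1 /= -natr1.
  have : (Num.truncn (16 * bmax * l / eps ^+ 2))%:R <= 16 * y.
    rewrite (_ : 16 * y = 16 * bmax * l / eps ^+ 2); last by rewrite /y !mulrA.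
    by rewrite truncn_le !mulr_ge0 ?invr_ge0 ?exprn_ge0 ?ltW.
  lra.
have k1 : 1 <= k%:R :> R by rewrite /k /num_bases leqNgt n1 /= ler1n.
rewrite natrM -natr1 natrM.
apply: (@le_trans _ _ (k%:R * (k%:R * (6 * l)))).
  rewrite ler_pM2l; last lra.
  have : k%:R * d%:R <= k%:R * (4 * l) by apply: ler_wpM2l.
  have : k%:R * (1 / 2) <= k%:R * l by apply: ler_wpM2l.
  lra.
apply: (@le_trans _ _ (32 * y * (32 * y * (6 * l)))).
  have l6 : 0 <= 6 * l by rewrite mulr_ge0// ltW.
  by apply: ler_pM => //; [apply: mulr_ge0|apply: ler_wpM2r].
rewrite le_eqVlt; apply/orP; left; apply/eqP.
rewrite /y -exprVn -[eps ^- 4]exprVn; set v := eps^-1; ring.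
Qed.

End Estimate.

(** Transitivity follows from the least element of [x, y, z], antisymmetry settling the cases where
    it is [y] or [z]. *)
Lemma well_order_total_order (T : eqType) (r : rel T) : well_order r ->
  [/\ total r, antisymmetric r & transitive r].
Proof.
move=> wo; have woT : wo_chain r predT by move=> A _; apply: wo.
have tot : total r by move=> x y; apply: (wo_chainW woT).
have anti : antisymmetric r by move=> x y; apply: (wo_chain_antisymmetric woT).
split=> // y x z xy yz.
have [|w [[wA lbw] _]] := wo [mem [:: x; y; z]]; first by exists x; rewrite !inE eqxx.
have lb t : t \in [:: x; y; z] -> r w t by apply: lbw.
have [wx wy wz] : [/\ r w x, r w y & r w z].
  by split; apply: lb; rewrite !inE eqxx ?orbT.
have /or3P[/eqP <-//|/eqP wE|/eqP wE] : [|| w == x, w == y | w == z].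
  by move: wA; rewrite !inE.
- by rewrite (anti x y) // xy -wE wx.
- by rewrite -(anti y z) // yz -wE wy.
Qed.

Local Close Scope fset_scope.
Unset Implicit Arguments.

Theorem theorem1p3 (R : realType) :
  exists2 C : R, 0 < C &
  forall (U : choiceType) (eps : R) (n : nat) (bmax : R),
    0 < eps -> eps < 1 / 2 ->
  exists alg : dyn_algorithm R U,
  forall (T : nat) (M : nat -> matroid U) (u : nat -> update U),
    dynamic_matroid T M u ->
    (forall t, (t <= T)%N -> (#|` ground (M t)| <= n)%N) ->
    (forall t, (t <= T)%N -> (fractional_covering R (M t) <= bmax%:E)%E) ->
  forall t, (t <= T)%N ->
    [/\ ((1 - eps)%:E * fractional_covering R (M t)
           <= (output_at alg M u t)%:E)%E,
        ((output_at alg M u t)%:E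
           <= (1 + eps)%:E * fractional_covering R (M t))%E,
        (forall A, A \in queries_at alg M u t -> (A `<=` ground (M t))%fset) &
        (0 < t)%N ->
        (size (queries_at alg M u t))%:R
          <= C * (bmax ^+ 2 * eps ^- 4 * ln n%:R ^+ 3)].
Proof.
exists 6144; first by rewrite ltr0n.
move=> U eps n bmax eps0 eps2.
(* A well-order supplies the fixed tie-breaking order on an arbitrary [U]. *)
have [ord /well_order_total_order[tot anti trans]] := well_ordering_principle U.
pose k := num_bases eps bmax n.
exists (greedy_algorithm ord (up_log 2 n) k (@estimate R U n)).
move=> T M u dyn size_n fc_le t tT.
have size_d s : (s <= T)%N -> (#|` ground (M s)| <= 2 ^ up_log 2 n)%N.
  by move=> sT; apply: leq_trans (size_n s sT) (up_logP _ _).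
have fc_fin s : (s <= T)%N -> exists2 b, fractional_covering R (M s) = b%:E & b <= bmax.
  move=> sT; have := fc_le s sT; have := fractional_covering_ge0 R (M s).
  by case: fractional_covering => [b _| |]//; rewrite ?lee_fin => ?; exists b.
have [-> sub bnd] := greedy_algorithm_correct tot anti trans k
  (@estimate R U n) dyn size_d tT.
have [b fcb bb] := fc_fin t tT.
have [lo up] := estimate_correct tot anti trans eps0 eps2 (size_n t tT) fcb bb.
rewrite fcb -!EFinM !lee_fin; split => // t0.
(* For [n <= 1] both sides vanish: no base is kept, and [ln] is 0 at 1 and, by convention, at 0. *)
case: (leqP n 1) => n1.
  have -> : size (queries_at (greedy_algorithm ord (up_log 2 n) k
      (@estimate R U n)) M u t) = 0%N.
    by apply/eqP; rewrite -leqn0; move: (bnd t0); rewrite /k /num_bases n1.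
  have -> : ln n%:R = 0 :> R.
    by case: (n) n1 => [|[|]]// _; rewrite ?ln1// ln0.
  by rewrite [0 ^+ 3]exprS mul0r !mulr0.
(* The updated element lies in the ground set before or after the update, and a nonempty ground set
   has covering number at least 1. *)
have bmax1 : 1 <= bmax.
  suff [s sT E0] : exists2 s, (s <= T)%N & ground (M s) != fset0.
    have [b' fcb' bb'] := fc_fin s sT.
    exact: le_trans (fractional_covering_ge1 fcb' E0) bb'.
  case: t t0 tT {sub bnd fcb bb lo up} => // t _ tT.
  have := update_spec_deletion (dyn t tT); case: (u t) => e [_ [eM _ _]].
    by exists t.+1 => //; apply/fset0Pn; exists e.
  by exists t; [exact: ltnW|apply/fset0Pn; exists e].
apply: le_trans (num_queries_le eps0 eps2 bmax1 n1).
by rewrite ler_nat; apply: bnd.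
Qed.
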